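(* Let $P\subset\mathbb{R}^2$ be an integral convex polytope which is lattice equivalent to $$Q=m[0,e_1]+n[0,e_2]+\ell[0,e_1+e_2]+s[0,e_1-e_2]+r\Delta$$ for some integers $m,n,\ell,s,r\ge 0$. Then $$L(P)=m+n+s+\ell+\begin{cases}\left\lfloor \frac{3r}{2}\right\rfloor & \text{if } r<2\ell,\\ \ell+r & \text{if } r\ge 2\ell.\end{cases}$$
   Context: An integral convex polytope (lattice polytope) in $\mathbb{R}^2$ is the convex hull of a nonempty finite subset of $\mathbb{Z}^2$. Here $e_1,e_2$ are the standard basis vectors, $[0,v]$ is the segment from $0$ to $v$, $\Delta=\operatorname{conv}\{(0,0),(1,0),(0,1)\}$, the sum of polytopes is the Minkowski sum $A+B=\{a+b:a\in A,b\in B\}$, and $kA=\{ka:a\in A\}$ is the dilate. Two lattice polytopes $P,Q\subset\mathbb{R}^2$ are lattice equivalent ($P\approx Q$) if $T(P)=Q$ for some map $T(x)=Ax+\lambda$ with $A\in\mathrm{GL}(2,\mathbb{Z})$, $\lambda\in\mathbb{Z}^2$. The Minkowski length $L(P)$ of a lattice polytope $P$ is the maximum number of non-trivial (i.e. at least one-dimensional) lattice polytopes whose Minkowski sum is contained in $P$ (it is $0$ if $P$ is a point). *)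

(* Defs.v *)
From mathcomp Require Import all_boot all_order all_algebra.
From mathcomp Require Import all_classical reals convex.

Set Implicit Arguments.
Unset Strict Implicit.
Unset Printing Implicit Defensive.

Import Order.TTheory GRing.Theory Num.Theory.

Local Open Scope classical_set_scope.
Local Open Scope ring_scope.

Definition conv_hull (R : realType) (A : set 'cV[R]_2) : set 'cV[R]_2 :=
  smallest (@convex_set R 'cV[R]_2) A.

Definition lattice_points (R : realType) : set 'cV[R]_2 :=
  range (map_mx intr : 'cV[int]_2 -> 'cV[R]_2).

Definition lattice_polytope (R : realType) (P : set 'cV[R]_2) : Prop :=
  exists A : set 'cV[R]_2,
    [/\ finite_set A, A !=set0, A `<=` @lattice_points R & P = conv_hull A].

Definition minkowski_add (R : realType) (A B : set 'cV[R]_2) : set 'cV[R]_2 :=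
  [set a + b | a in A & b in B].

Definition dilate (R : realType) (k : nat) (A : set 'cV[R]_2) : set 'cV[R]_2 :=
  [set k%:R *: a | a in A].

Definition e1 (R : realType) : 'cV[R]_2 := delta_mx 0 0.
Definition e2 (R : realType) : 'cV[R]_2 := delta_mx 1 0.

Definition segment0 (R : realType) (v : 'cV[R]_2) : set 'cV[R]_2 :=
  [set t *: v | t in `[0, 1]].

Definition Delta (R : realType) : set 'cV[R]_2 :=
  conv_hull [set 0; @e1 R; @e2 R].

Definition lattice_equivalent (R : realType) (P Q : set 'cV[R]_2) : Prop :=
  exists A : 'M[int]_2, exists lam : 'cV[int]_2,
    A \in unitmx /\
    [set map_mx intr A *m x + map_mx intr lam | x in P] = Q.

Definition nontrivial (R : realType) (P : set 'cV[R]_2) : Prop :=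
  exists x y, [/\ P x, P y & x != y].

Definition minkowski_sum (R : realType) (k : nat)
    (F : 'I_k -> set 'cV[R]_2) : set 'cV[R]_2 :=
  \big[@minkowski_add R/[set 0]]_(i < k) F i.

(* The case [k = 0] is put in by hand: the empty Minkowski sum is [[set 0]],
   which need not lie in [P], whereas a point has Minkowski length 0. *)
Definition summand_count (R : realType) (P : set 'cV[R]_2) (k : nat) : Prop :=
  k = 0%N \/
  exists F : 'I_k -> set 'cV[R]_2,
    (forall i, lattice_polytope (F i) /\ nontrivial (F i)) /\
    minkowski_sum F `<=` P.

(* [L(P) = k], as a relation so that the existence of the maximum is part of
   the assertion. *)
Definition minkowski_length_is (R : realType) (P : set 'cV[R]_2) (k : nat) :
    Prop :=
  summand_count P k /\ (forall j, summand_count P j -> (j <= k)%N).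

Definition Qpoly (R : realType) (m n l s r : nat) : set 'cV[R]_2 :=
  minkowski_add (minkowski_add (minkowski_add (minkowski_add
    (dilate m (segment0 (@e1 R)))
    (dilate n (segment0 (@e2 R))))
    (dilate l (segment0 (@e1 R + @e2 R))))
    (dilate s (segment0 (@e1 R - @e2 R))))
    (dilate r (@Delta R)).

(* Main.v *)
Require Import Defs.
From mathcomp Require Import all_boot all_order all_algebra.
From mathcomp Require Import all_classical reals.
From mathcomp Require Import convex interval_inference zify ring lra.

(** Every non-trivial lattice polytope contains a lattice segment, so summands
may be taken to be segments: [L(P)] is the largest number of generators of a
lattice zonotope [c + \sum_i [0, v_i]], with all [v_i] nonzero, inside [P]
([summand_countP]).  An affine unimodular map carries such zonotopes to such
zonotopes, hence [L(P) = L(Q)] ([minkowski_length_equivalent]).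

Upper bound ([Qpoly_zonotope_le]).  If the zonotope lies in [Q], then for each
integer direction [u] the support functions compare:
[u.c + \sum_i max(0, u.v_i) <= h_Q(u)].  Summing over directions [u] of total
zero cancels [c].  Two such families are enough.
- For [(-1,0), (0,-1), (1,1)], the values [h_Q] add up to [m + n + s + 2l + r],
  and each nonzero integer vector contributes at least 1 on the left.
- For [(1,1), (-1,-1), (1,-1), (-1,1)], they add up to
  [2 (m + n + s + l) + 3r], and each vector [(x, y)] contributes
  [|x + y| + |x - y| >= 2].
So [L(Q) <= m + n + s + l + min (l + r) (floor (3r / 2))], and the case
distinction in the formula decides which of the two bounds is the smaller.

Lower bound ([Qpoly_has_zonotope]).  The polygon [[0, e1 + e2] + 2 Delta]
contains the square [2 [0, e1] + 2 [0, e2]]: four segments where the evident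
count is three.  Using this [k = min l (floor (r / 2))] times, and
[[0, e1]] inside every remaining copy of [Delta], gives
[m + n + s + l + r + k] segments, which is the upper bound. *)

Set Implicit Arguments.
Unset Strict Implicit.
Unset Printing Implicit Defensive.

Import Order.TTheory GRing.Theory Num.Theory.

Local Open Scope classical_set_scope.
Local Open Scope ring_scope.

Section MinkowskiLength.
Variable R : realType.
Implicit Types (P Q A B : set 'cV[R]_2) (x y z : 'cV[R]_2).

Local Notation real_mx := (map_mx (intr : int -> R)).

(** * Convex hulls and Minkowski sums *)

Lemma col2_eq x y : x 0 0 = y 0 0 -> x 1 0 = y 1 0 -> x = y.
Proof.
move=> h0 h1; apply/colP => i; case: i => [[|[|//]] Hi].
  by rewrite (_ : Ordinal Hi = 0) //; apply/val_inj.
by rewrite (_ : Ordinal Hi = 1) //; apply/val_inj.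
Qed.

Lemma col2_neq0 (v : 'cV[int]_2) : v != 0 -> (v 0 0 != 0) || (v 1 0 != 0).
Proof.
apply: contraR; rewrite negb_or !negbK => /andP[/eqP h0 /eqP h1].
apply/eqP/colP => i; rewrite mxE; case: i => [[|[|//]] Hi].
  by rewrite -[RHS]h0; congr (v _ _); apply/val_inj.
by rewrite -[RHS]h1; congr (v _ _); apply/val_inj.
Qed.

Lemma convex_setP A : convex_set A <->
  forall x y (t : R), 0 <= t -> t <= 1 -> A x -> A y ->
    A (t *: x + (1 - t) *: y).
Proof.
split=> [cA x y t t0 t1 Ax Ay|cA x y t /set_mem Ax /set_mem Ay].
  have := cA x y (Itv01 t0 t1) (mem_set Ax) (mem_set Ay).
  by move/set_mem.
by apply/mem_set; exact: cA.
Qed.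

Lemma convex_conv_hull A : convex_set (conv_hull A).
Proof.
apply/convex_setP => x y t t0 t1 hx hy B [cB AB].
by move/convex_setP: (cB); apply=> //; [exact: hx|exact: hy].
Qed.

Lemma conv_hull_segment x y z : conv_hull [set x; y] z <->
  exists2 t : R, 0 <= t <= 1 & z = x + t *: (y - x).
Proof.
split.
  apply: (@smallest_sub _ _ _
    [set z | exists2 t : R, 0 <= t <= 1 & z = x + t *: (y - x)]).
    apply/convex_setP => a b t t0 t1 [p p01 ->] [q q01 ->].
    exists (t * p + (1 - t) * q); first by apply/andP; split; nra.
    by apply: col2_eq; rewrite !mxE; ring.
  move=> _ [->|->].
    by exists 0; rewrite ?lexx ?ler01 // scale0r addr0.
  by exists 1; rewrite ?lexx ?ler01 // scale1r addrC subrK.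
move=> [t /andP[t0 t1] ->].
have -> : x + t *: (y - x) = t *: y + (1 - t) *: x.
  by apply: col2_eq; rewrite !mxE; ring.
have /convex_setP cH := @convex_conv_hull [set x; y].
have Hx : conv_hull [set x; y] x by apply: sub_gen_smallest; left.
have Hy : conv_hull [set x; y] y by apply: sub_gen_smallest; right.
exact: cH.
Qed.

Lemma conv_hull1 x : conv_hull [set x] = [set x].
Proof.
apply: smallest_id; apply/convex_setP => a b t _ _ -> ->.
by apply: col2_eq; rewrite !mxE; ring.
Qed.

Lemma minkowski_sumP k (F : 'I_k -> set 'cV[R]_2) z :
  minkowski_sum F z <->
  exists2 x : 'I_k -> 'cV[R]_2, forall i, F i (x i) & z = \sum_i x i.
Proof.
rewrite /minkowski_sum; elim: k F z => [|k IH] F z.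
  rewrite big_ord0; split=> [->|[x _ ->]]; last by rewrite big_ord0.
  by exists (fun=> 0); [case|rewrite big_ord0].
rewrite big_ord_recl; split.
  case=> a Fa [b /IH [x Fx ->] <-].
  exists (fun i => oapp x a (unlift ord0 i)) => [i|].
    by case: unliftP => [j ->|->] //=.
  rewrite big_ord_recl unlift_none; congr (_ + _).
  by apply: eq_bigr => i _; rewrite liftK.
case=> x Fx ->; rewrite big_ord_recl.
exists (x ord0) => //; exists (\sum_(i < k) x (lift ord0 i)) => //.
by apply/IH; exists (fun i => x (lift ord0 i)).
Qed.

(** * Counting summands with lattice zonotopes *)

(** The segments are recorded by their direction vectors, all translations
being collected in the single vector [c]. *)
Definition has_zonotope A (k : nat) : Prop :=
  exists (c : 'cV[int]_2) (v : 'I_k -> 'cV[int]_2),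
    (forall i, v i != 0) /\
    forall t : 'I_k -> R, (forall i, 0 <= t i <= 1) ->
      A (real_mx c + \sum_i t i *: real_mx (v i)).

(** The generating lattice points of a non-trivial hull cannot all coincide,
since the hull of one point is that point; two distinct ones span the
segment. *)
Lemma nontrivial_lattice_segment A : lattice_polytope A -> nontrivial A ->
  exists a v : 'cV[int]_2, v != 0 /\
    forall t : R, 0 <= t <= 1 -> A (real_mx a + t *: real_mx v).
Proof.
case=> S [_ [p Sp] Slat ->] [x [y [Ax Ay xy]]].
have [q [Sq pq]] : exists q, S q /\ q != p.
  apply: contrapT => nq.
  have Sp1 : S `<=` [set p].
    by move=> q Sq; apply: contrapT => /eqP qp; apply: nq; exists q.
  have hull1 : conv_hull S `<=` [set p].
    rewrite -[X in _ `<=` X]conv_hull1; apply: sub_smallest2r => //.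
    exact: convex_conv_hull.
  by move: xy; rewrite (hull1 _ Ax) (hull1 _ Ay) eqxx.
have [a _ ea] := Slat _ Sp; have [b _ eb] := Slat _ Sq.
exists a, (b - a); split=> [|t t01].
  by apply: contraNneq pq => /subr0_eq ba; rewrite -ea -eb ba.
have pqS : conv_hull [set p; q] `<=` conv_hull S.
  apply: sub_smallest2r; first exact: convex_conv_hull.
  by move=> _ [->|->].
apply: pqS; apply/conv_hull_segment; exists t => //.
by rewrite map_mxB ea eb.
Qed.

(** From summands to a zonotope, each summand is replaced by a segment in it.
Conversely the segments of a zonotope are summands once its translation vector
has been given to one of them, which is possible as soon as there is one. *)
Lemma summand_countP A k : summand_count A k <-> k = 0%N \/ has_zonotope A k.
Proof.
split=> -[->|]; try by left.
  case=> F [Fpoly FA]; right.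
  have /choice[av avP] : forall i, exists av : 'cV[int]_2 * 'cV[int]_2,
      av.2 != 0 /\ forall t : R, 0 <= t <= 1 ->
        F i (real_mx av.1 + t *: real_mx av.2).
    move=> i; have [Fi ni] := Fpoly i.
    by have [a [v h]] := nontrivial_lattice_segment Fi ni; exists (a, v).
  exists (\sum_i (av i).1), (fun i => (av i).2).
  split=> [i|t t01]; first by case: (avP i).
  apply: FA; apply/minkowski_sumP.
  exists (fun i => real_mx (av i).1 + t i *: real_mx (av i).2).
    by move=> i; have [_ segF] := avP i; exact: segF.
  by rewrite big_split raddf_sum.
case: k => [|k]; first by left.
case=> c [v [v0 vA]]; right.
(* The first segment starts at [c], the others at the origin. *)
pose shift i : 'cV[int]_2 := if i == ord0 :> 'I_k.+1 then c else 0.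
exists (fun i => conv_hull [set real_mx (shift i); real_mx (shift i + v i)]).
split=> [i|z /minkowski_sumP[x xP ->]].
  split.
    exists [set real_mx (shift i); real_mx (shift i + v i)].
    split=> //; first by exists (real_mx (shift i)); left.
    by move=> _ [->|->]; eexists.
  exists (real_mx (shift i)), (real_mx (shift i + v i)).
  split; first by apply: sub_gen_smallest; left.
    by apply: sub_gen_smallest; right.
  apply: contra (v0 i) => /eqP e; apply/eqP.
  have: real_mx (v i) = real_mx 0.
    move: e; rewrite map_mxD map_mx0 => /esym/(canRL (addKr _)) ->.
    by rewrite addNr.
  by move/colP => e0; apply/colP => j; move: (e0 j); rewrite !mxE => /intr_inj.
have /choice[t tP] : forall i, exists t : R,
    0 <= t <= 1 /\ x i = real_mx (shift i) + t *: real_mx (v i).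
  move=> i; have /conv_hull_segment[t t01 ->] := xP i.
  by exists t; rewrite map_mxD [_ + _ - _]addrC addKr.
rewrite (eq_bigr _ (fun i _ => (tP i).2)) big_split /= -raddf_sum /=.
have -> : \sum_i shift i = c.
  by rewrite (bigD1 ord0) //= /shift eqxx big1 ?addr0 // => i /negbTE ->.
by apply: vA => i; case: (tP i).
Qed.

(** * Invariance under lattice equivalence *)

Lemma lattice_equivalent_sym P Q :
  lattice_equivalent P Q -> lattice_equivalent Q P.
Proof.
case=> M [lam [uM <-]].
exists (invmx M), (- (invmx M *m lam)); split; first by rewrite unitmx_inv.
have K x : real_mx (invmx M) *m (real_mx M *m x + real_mx lam) +
    real_mx (- (invmx M *m lam)) = x.
  rewrite mulmxDr mulmxA -!map_mxM mulVmx // map_mx1 mul1mx.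
  by rewrite -addrA -map_mxD subrr map_mx0 addr0.
apply/seteqP; split=> [_ [_ [x Px <-] <-]|x Px]; first by rewrite K.
by exists (real_mx M *m x + real_mx lam) => //; exists x.
Qed.

Lemma summand_count_equivalent P Q k :
  lattice_equivalent P Q -> summand_count P k -> summand_count Q k.
Proof.
case=> M [lam [uM <-]] /summand_countP[->|[c [v [v0 vP]]]]; first by left.
apply/summand_countP; right.
exists (M *m c + lam), (fun i => M *m v i); split=> [i|t t01].
  by apply: contraNneq (v0 i) => Mv; rewrite -(mulKmx uM (v i)) Mv mulmx0.
exists (real_mx c + \sum_i t i *: real_mx (v i)); first exact: vP.
rewrite mulmxDr map_mxD map_mxM addrAC mulmx_sumr; congr (_ + _ + _).
by apply: eq_bigr => i _; rewrite map_mxM scalemxAr.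
Qed.

Lemma minkowski_length_equivalent P Q k : lattice_equivalent P Q ->
  minkowski_length_is Q k -> minkowski_length_is P k.
Proof.
move=> PQ [Qk maxk]; split=> [|j Pj].
  exact: (summand_count_equivalent (lattice_equivalent_sym PQ)).
by apply: maxk; exact: summand_count_equivalent Pj.
Qed.

(** * Coordinates on the model polygon *)

Lemma dilate_segmentP k (v : 'cV[R]_2) z : dilate k (segment0 v) z <->
  exists2 t : R, 0 <= t <= k%:R & z = t *: v.
Proof.
split=> [[_ [t t01 <-] <-]|[t /andP[t0 tk] ->]].
  exists (k%:R * t); last by rewrite scalerA.
  by move: t01; rewrite /= in_itv /= => /andP[t0 t1]; have := ler0n R k; nra.
have [k0|k0] := eqVneq (k%:R : R) 0.
  exists 0; first by exists 0; rewrite ?scale0r //= in_itv /= lexx ler01.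
  have -> : t = 0 by apply/eqP; rewrite eq_le t0 -k0 tk.
  by rewrite scale0r scaler0.
have kp : 0 < k%:R :> R by rewrite lt0r k0 ler0n.
exists ((t / k%:R) *: v); last by rewrite scalerA mulrC divfK.
exists (t / k%:R) => //; rewrite /= in_itv /= divr_ge0 ?ler0n //=.
by rewrite ler_pdivrMr // mul1r.
Qed.

(** A point [(p, q)] of [Delta] other than the origin lies on the segment from
the origin to the point of [[e1, e2]] obtained by dividing by [p + q]. *)
Lemma dilate_DeltaP k z : dilate k (@Delta R) z <->
  [/\ 0 <= z 0 0, 0 <= z 1 0 & z 0 0 + z 1 0 <= k%:R].
Proof.
have DeltaP y : Delta y <-> [/\ 0 <= y 0 0, 0 <= y 1 0 & y 0 0 + y 1 0 <= 1].
  split.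
    apply: (@smallest_sub _ _ _
      [set y : 'cV[R]_2 | [/\ 0 <= y 0 0, 0 <= y 1 0 & y 0 0 + y 1 0 <= 1]]).
      apply/convex_setP => a b t t0 t1 [? ? ?] [? ? ?].
      by split; rewrite !mxE; nra.
    by move=> _ [[->|->]|->]; rewrite /e1 /e2; split; rewrite /= ?mxE /=; lra.
  move=> [y0 y1 y01].
  have /convex_setP cD := @convex_conv_hull [set 0; @e1 R; @e2 R].
  have De1 : Delta (@e1 R) by apply: sub_gen_smallest; left; right.
  have De2 : Delta (@e2 R) by apply: sub_gen_smallest; right.
  have D0 : @Delta R 0 by apply: sub_gen_smallest; left; left.
  set w := y 0 0 + y 1 0.
  have [w0|w0] := eqVneq w 0.
    suff -> : y = 0 by [].
    by apply: col2_eq; rewrite !mxE; move: w0; rewrite /w; lra.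
  have wp : 0 < w by rewrite lt0r w0 addr_ge0.
  have -> : y = w *: ((y 0 0 / w) *: @e1 R + (1 - y 0 0 / w) *: @e2 R) +
      (1 - w) *: 0.
    by apply: col2_eq; rewrite /e1 /e2 !mxE /= /w; field.
  apply: (cD) => //; first exact: ltW.
  apply: cD => //; first by rewrite divr_ge0 // ltW.
  by rewrite ler_pdivrMr // mul1r /w lerDl.
have k_ge0 := ler0n R k.
split=> [[y /DeltaP[y0 y1 y01] <-]|[z0 z1 z01]].
  by rewrite !mxE; split; nra.
have [k0|k0] := eqVneq (k%:R : R) 0.
  exists 0; first by apply/DeltaP; rewrite !mxE; split; lra.
  by apply: col2_eq; rewrite !mxE; move: k0 z01; lra.
have kp : 0 < k%:R :> R by rewrite lt0r k0 ler0n.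
exists (k%:R^-1 *: z); last by rewrite scalerA mulfV // scale1r.
apply/DeltaP; rewrite !mxE; split; try by rewrite mulr_ge0 ?invr_ge0.
by rewrite -mulrDr mulrC ler_pdivrMr // mul1r.
Qed.

Lemma QpolyP m n l s r z : Qpoly m n l s r z <->
  exists a b c d p q : R,
  [/\ [/\ 0 <= a <= m%:R, 0 <= b <= n%:R, 0 <= c <= l%:R & 0 <= d <= s%:R],
      [/\ 0 <= p, 0 <= q & p + q <= r%:R],
      z 0 0 = a + c + d + p & z 1 0 = b + c - d + q].
Proof.
split.
  case=> _ [_ [_ [_ /dilate_segmentP[a ha ->] [_ /dilate_segmentP[b hb ->] <-]]
    [_ /dilate_segmentP[c hc ->] <-]] [_ /dilate_segmentP[d hd ->] <-]]
    [y /dilate_DeltaP yP <-].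
  exists a, b, c, d, (y 0 0), (y 1 0); split=> //;
    by rewrite /e1 /e2 !mxE /=; ring.
move=> [a [b [c [d [p [q [[ha hb hc hd] hpq z0 z1]]]]]]].
exists (a *: @e1 R + b *: @e2 R + c *: (@e1 R + @e2 R) + d *: (@e1 R - @e2 R)).
  exists (a *: @e1 R + b *: @e2 R + c *: (@e1 R + @e2 R)).
    exists (a *: @e1 R + b *: @e2 R).
      exists (a *: @e1 R); first by apply/dilate_segmentP; exists a.
      by exists (b *: @e2 R) => //; apply/dilate_segmentP; exists b.
    by exists (c *: (@e1 R + @e2 R)) => //; apply/dilate_segmentP; exists c.
  by exists (d *: (@e1 R - @e2 R)) => //; apply/dilate_segmentP; exists d.
exists (p *: @e1 R + q *: @e2 R).
  apply/dilate_DeltaP.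
  by rewrite /e1 /e2 !mxE /= !(mulr0, mulr1, addr0, add0r).
by apply: col2_eq; rewrite ?z0 ?z1 /e1 /e2 !mxE /=; ring.
Qed.

(** * Upper bound *)

(** The linear form [(a, b)] attains its maximum on the zonotope at the vertex
that uses exactly the generators on which the form is positive.  That vertex is
a lattice point, so the inequality holds between integers. *)
Lemma zonotope_support A k (c : 'cV[int]_2) (v : 'I_k -> 'cV[int]_2)
    (a b h : int) :
  (forall t : 'I_k -> R, (forall i, 0 <= t i <= 1) ->
     A (real_mx c + \sum_i t i *: real_mx (v i))) ->
  (forall z, A z -> a%:~R * z 0 0 + b%:~R * z 1 0 <= h%:~R) ->
  a * c 0 0 + b * c 1 0 + \sum_i Num.max 0 (a * v i 0 0 + b * v i 1 0) <= h.
Proof.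
move=> vA Ah.
pose t i : R := if 0 < a * v i 0 0 + b * v i 1 0 then 1 else 0.
have t01 i : 0 <= t i <= 1 by rewrite /t; case: ifP => _; rewrite ?lexx ?ler01.
have := Ah _ (vA _ t01).
rewrite !mxE !summxE !mulrDr addrACA -(ler_int R) !rmorphD /= !rmorphM /=.
congr (_ + _ <= _).
rewrite !mulr_sumr -big_split rmorph_sum /=; apply: eq_bigr => i _.
rewrite !mxE /t; case: ltP => _.
  by rewrite !mul1r rmorphD !rmorphM.
by rewrite !mul0r !mulr0 addr0.
Qed.

(** The two bounds come from the triangle of directions [(-1,0), (0,-1), (1,1)]
and from the square of directions [(+-1, +-1)]; in each family the directions
sum to zero, so that the translation vector of the zonotope disappears. *)
Lemma Qpoly_zonotope_le m n l s r k : has_zonotope (Qpoly m n l s r) k ->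
  (k <= m + n + s + 2 * l + r /\ 2 * k <= 2 * (m + n + s + l) + 3 * r)%N.
Proof.
case=> c [v [v0 vQ]].
pose width a b : int := \sum_i Num.max 0 (a * v i 0 0 + b * v i 1 0).
have support (a b h : int) : (forall z, Qpoly m n l s r z ->
    a%:~R * z 0 0 + b%:~R * z 1 0 <= h%:~R :> R) ->
    a * c 0 0 + b * c 1 0 + width a b <= h.
  exact: zonotope_support vQ.
have west : -1 * c 0 0 + 0 * c 1 0 + width (-1) 0 <= 0%:Z.
  apply: support => z /QpolyP[a [b [x [d [p [q []]]]]]].
  move=> [ha hb hx hd] [hp hq hpq] -> ->.
  by lra.
have south : 0 * c 0 0 + -1 * c 1 0 + width 0 (-1) <= s%:Z.
  apply: support => z /QpolyP[a [b [x [d [p [q []]]]]]].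
  move=> [ha hb hx hd] [hp hq hpq] -> ->.
  by rewrite -pmulrn; lra.
have northeast : 1 * c 0 0 + 1 * c 1 0 + width 1 1 <= (m + n + 2 * l + r)%:Z.
  apply: support => z /QpolyP[a [b [x [d [p [q []]]]]]].
  move=> [ha hb hx hd] [hp hq hpq] -> ->.
  by rewrite -pmulrn !natrD; lra.
have southwest : -1 * c 0 0 + -1 * c 1 0 + width (-1) (-1) <= 0%:Z.
  apply: support => z /QpolyP[a [b [x [d [p [q []]]]]]].
  move=> [ha hb hx hd] [hp hq hpq] -> ->.
  by lra.
have southeast : 1 * c 0 0 + -1 * c 1 0 + width 1 (-1) <= (m + 2 * s + r)%:Z.
  apply: support => z /QpolyP[a [b [x [d [p [q []]]]]]].
  move=> [ha hb hx hd] [hp hq hpq] -> ->.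
  by rewrite -pmulrn !natrD; lra.
have northwest : -1 * c 0 0 + 1 * c 1 0 + width (-1) 1 <= (n + r)%:Z.
  apply: support => z /QpolyP[a [b [x [d [p [q []]]]]]].
  move=> [ha hb hx hd] [hp hq hpq] -> ->.
  by rewrite -pmulrn !natrD; lra.
(* A nonzero integer vector with no negative coordinate has a positive sum. *)
have tri : k%:Z <= width (-1) 0 + width 0 (-1) + width 1 1.
  rewrite /width -!big_split /= -{1}(card_ord k) -sum1_card.
  rewrite (big_morph Posz PoszD erefl).
  by apply: ler_sum => i _; have := col2_neq0 (v0 i); lia.
(* Here a vector contributes [|x + y| + |x - y| = 2 max(|x|, |y|)]. *)
have quad : (2 * k)%:Z <=
    width 1 1 + width (-1) (-1) + width 1 (-1) + width (-1) 1.
  rewrite /width -!big_split /= mulnC -{1}(card_ord k) -sum_nat_const.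
  rewrite (big_morph Posz PoszD erefl).
  by apply: ler_sum => i _; have := col2_neq0 (v0 i); lia.
by split; lia.
Qed.

(** * Lower bound *)

Lemma has_zonotope_sub A B k : A `<=` B -> has_zonotope A k -> has_zonotope B k.
Proof. by move=> AB [c [v [v0 vA]]]; exists c, v; split=> // t /vA /AB. Qed.

Lemma has_zonotope_dilate k (v : 'cV[int]_2) : v != 0 ->
  has_zonotope (dilate k (segment0 (real_mx v))) k.
Proof.
move=> v0; exists 0, (fun=> v); split=> // t t01; apply/dilate_segmentP.
exists (\sum_i t i); last by rewrite map_mx0 add0r scaler_suml.
rewrite sumr_ge0 /=; last by move=> i _; case/andP: (t01 i).
rewrite -[k in k%:R]card_ord -sum1_card natr_sum.
by apply: ler_sum => i _; case/andP: (t01 i).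
Qed.

Lemma has_zonotope_add A B j k : has_zonotope A j -> has_zonotope B k ->
  has_zonotope (minkowski_add A B) (j + k).
Proof.
case=> c [v [v0 vA]] [d [w [w0 wB]]].
exists (c + d), (fun i =>
  match fintype.split i with inl i1 => v i1 | inr i2 => w i2 end).
split=> [i|t t01]; first by case: fintype.split.
exists (real_mx c + \sum_i t (lshift k i) *: real_mx (v i)); first exact: vA.
exists (real_mx d + \sum_i t (rshift j i) *: real_mx (w i)); first exact: wB.
rewrite addrACA map_mxD big_split_ord; congr (_ + (_ + _));
  apply: eq_bigr => i _; congr (_ *: real_mx _).
  by rewrite -[lshift k i]/(unsplit (inl i)) unsplitK.
by rewrite -[rshift j i]/(unsplit (inr i)) unsplitK.
Qed.

(** Among the [r] triangles, [2k] are combined in pairs with [k] of the diagonal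
segments, each such group containing a [2 x 2] square, and the others contribute
[[0, e1]].  Altogether this zonotope has [m + r] generators [e1], [n + 2k]
generators [e2], [l - k] generators [e1 + e2] and [s] generators [e1 - e2]. *)
Lemma Qpoly_has_zonotope m n l s r k : (k <= l)%N -> (2 * k <= r)%N ->
  has_zonotope (Qpoly m n l s r) (m + n + s + l + (r + k)).
Proof.
move=> kl kr.
pose f1 : 'cV[int]_2 := delta_mx 0 0; pose f2 : 'cV[int]_2 := delta_mx 1 0.
(* The form [2x + y] vanishes on none of the four directions. *)
have nz (v : 'cV[int]_2) : v 0 0 + v 1 0 + v 0 0 != 0 -> v != 0.
  by apply: contraNneq => ->; rewrite !mxE.
have f1_nz : f1 != 0 by apply: nz; rewrite /f1 !mxE.
have f2_nz : f2 != 0 by apply: nz; rewrite /f2 !mxE.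
have f12_nz : f1 + f2 != 0 by apply: nz; rewrite /f1 /f2 !mxE.
have f12'_nz : f1 - f2 != 0 by apply: nz; rewrite /f1 /f2 !mxE.
have -> : (m + n + s + l + (r + k) =
    (m + r) + (n + 2 * k) + (l - k) + s)%N by lia.
apply: has_zonotope_sub (has_zonotope_add (has_zonotope_add (has_zonotope_add
  (has_zonotope_dilate (m + r) f1_nz) (has_zonotope_dilate (n + 2 * k) f2_nz))
  (has_zonotope_dilate (l - k) f12_nz)) (has_zonotope_dilate s f12'_nz)).
move=> _ [_ [_ [_ /dilate_segmentP[a ha ->] [_ /dilate_segmentP[b hb ->] <-]]
  [_ /dilate_segmentP[c hc ->] <-]] [_ /dilate_segmentP[d hd ->] <-]].
have kr' : 2 * k%:R <= r%:R :> R by rewrite -natrM ler_nat.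
have k0 := ler0n R k; have m0 := ler0n R m; have n0 := ler0n R n.
have r0 := ler0n R r.
move: ha hb hc; rewrite natrD (natrD _ n) natrM natrB // => ha hb hc.
(* Fill up [[0, m e1]] and [[0, n e2]] first; the excess [(a - a1, b - b1)] lies
   in the rectangle [[0, r] x [0, 2k]].  Moving it back along the diagonal as far
   as the [k] diagonal segments and the axes allow brings it into [r Delta]. *)
pose a1 := Num.min a m%:R; pose b1 := Num.min b n%:R.
pose t := Num.min k%:R (Num.min (a - a1) (b - b1)).
have [a1_ge a1_le aa1] : [/\ 0 <= a1, a1 <= m%:R & 0 <= a - a1 <= r%:R].
  by rewrite /a1; case: (leP a m%:R) => ?; split; try (apply/andP; split); lra.
have [b1_ge b1_le bb1] : [/\ 0 <= b1, b1 <= n%:R & 0 <= b - b1 <= 2 * k%:R].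
  by rewrite /b1; case: (leP b n%:R) => ?; split; try (apply/andP; split); lra.
have [t_ge t_lek [t_lea t_leb] t_r] : [/\ 0 <= t, t <= k%:R,
    t <= a - a1 /\ t <= b - b1 & (a - a1 - t) + (b - b1 - t) <= r%:R].
  rewrite /t; move: (a - a1) (b - b1) aa1 bb1 => x y hx hy.
  by case: (leP x y) => ?; [case: (leP k%:R x)|case: (leP k%:R y)] => ?;
    split; try split; lra.
apply/QpolyP; exists a1, b1, (c + t), d, (a - a1 - t), (b - b1 - t).
split=> //; try (by split=> //; try (apply/andP; split); lra).
  by rewrite /f1 /f2 !mxE /=; ring.
by rewrite /f1 /f2 !mxE /=; ring.
Qed.

End MinkowskiLength.

Theorem proposition3p5 (R : realType) (P : set 'cV[R]_2)
    (m n l s r : nat) :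
  lattice_polytope P ->
  lattice_equivalent P (Qpoly m n l s r) ->
  minkowski_length_is P
    (m + n + s + l + (if r < 2 * l then (3 * r) %/ 2 else l + r))%N.
Proof.
move=> _ PQ; apply: (minkowski_length_equivalent PQ); split.
  have -> : ((if r < 2 * l then (3 * r) %/ 2 else l + r) =
      r + minn l (r %/ 2))%N by case: ifP; lia.
  by apply/summand_countP; right; apply: Qpoly_has_zonotope; lia.
move=> j /summand_countP[->//|/Qpoly_zonotope_le[]].
by case: ifP; lia.
Qed.
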